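(* Let $\mathcal{X}^1,\dots,\mathcal{X}^M$ be smooth complete Riemannian manifolds, let $p\ge1$, and let $\pi=e^{-f}\in\mathcal{P}_p(\times_{i=1}^M\mathcal{X}^i)$. Let $\mu_\star=\mu_\star^1\otimes\dots\otimes\mu_\star^M$ satisfy $\mu_\star^i=\mu_\star^i[\mu_\star^{-i}]$ and $\mu^i_\star\in\mathcal{P}_p(\mathcal{X}^i)$ for all $i$. Assume: (i) for all $i=1,\dots,M$, the optimality map $\mu_\star^i[\cdot]:\times_{j\ne i}\mathcal{P}(\mathcal{X}^j)\to\mathcal{P}(\mathcal{X}^i)$ is Fisher-smooth with constants $\{L_{ij}\}_{j\neq i}$ on $\times_{j\ne i}B_{\varepsilon_j}(\mu_\star^j)$; (ii) for all $i=1,\dots,M$, $\mu_\star^i$ satisfies a transportation-information inequality with constant $\lambda_i$. Define $R\in\mathbb{R}^{M\times M}$ by $R_{ij}=L_{ij}/\lambda_i$ for $i\ne j$ and $R_{ii}=0$. Suppose $\rho(R)<1$, let $\delta\in(0,\infty)^M$ satisfy $R\delta\prec\delta$, and let $c>0$ be such that $c\,\delta_i\le\varepsilon_i$ for all $i$. If $\mu_k^i\in B_{c\delta_i}(\mu_\star^i)$ for all $i=1,\dots,M$, then the random-scan CAVI algorithm, which draws $I\sim\mathrm{Unif}(\{1,\dots,M\})$ and sets $\mu_{k+1}^I=\mu_\star^I[\mu_k^{-I}]$ and $\mu_{k+1}^{j}=\mu_k^{j}$ for $j\ne I$, satisfies $$\mathbb{E}[W_{k+1,p}]\preceq\left(\frac1M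 R+\frac{M-1}{M}I_M\right)W_{k,p},$$ where the expectation is over the choice of $I$. In particular, $\mu_{k+1}^i\in B_{c\delta_i}(\mu_\star^i)$ for all $i=1,\dots,M$, and the random-scan CAVI algorithm converges exponentially fast to $\mu_\star$ in expected Wasserstein-$p$ distance with rate $\rho\left(\frac1M R+\frac{M-1}{M}I_M\right)$.
   Context: For a smooth complete Riemannian manifold $\mathcal{X}$ with geodesic distance $\mathsf{d}$ and volume measure $dx$, $\mathcal{P}(\mathcal{X})$ is the set of probability measures and $\mathcal{P}_p(\mathcal{X})$ the set of those absolutely continuous with respect to $dx$ with finite $p$-th moment. Measures are identified with their densities. $\mathbb{W}_p(\varrho_1,\varrho_2)=\inf_{\gamma}(\int \mathsf{d}(x_1,x_2)^p\,d\gamma)^{1/p}$ over couplings $\gamma$; $B_\varepsilon(\varrho)=\{\mu\in\mathcal{P}_p(\mathcal{X}):\mathbb{W}_p(\mu,\varrho)<\varepsilon\}$, $\varepsilon\in(0,\infty]$. Relative Fisher information: $\mathcal{I}(\varrho_1\|\varrho_2)=\int|\nabla\log\frac{d\varrho_1}{d\varrho_2}|^2\,d\varrho_1$ if $\varrho_1\ll\varrho_2$, and $+\infty$ otherwise. Optimality maps: for $\mu^{-i}=(\mu^j)_{j\ne i}$, $\mu_\star^i[\mu^{-i}](x_i)\propto\exp\left(-\mathbb{E}_{\bigotimes_{j\ne i}\mu^j}[f(X^{<i},x_i,X^{>i})]\right)$, where $X^{<i}=(X^1,\dots,X^{i-1})$ and $X^{>i}=(X^{i+1},\dots,X^M)$;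 it is the minimiser of $\mathrm{KL}(\cdot\,\|\pi)$ over the $i$-th factor with the others fixed. The maps are assumed to be well defined at the measures to which they are applied. Fisher-smoothness: $\mu_\star^i[\cdot]$ is Fisher-smooth with constants $\{L_{ij}\}_{j\ne i}$, $L_{ij}\ge0$, on $\times_{j\ne i}B_{\varepsilon_j}(\mu_\star^j)$ if $\mathcal{I}(\mu_\star^i[\mu^{-i}]\|\mu_\star^i[\mu_\star^{-i}])\le\left(\sum_{j\ne i}L_{ij}\mathbb{W}_p(\mu^j,\mu_\star^j)\right)^2$ for all $\mu^j\in B_{\varepsilon_j}(\mu_\star^j)$, $j\neq i$. Transportation-information inequality: $\gamma\in\mathcal{P}_p(\mathcal{X})$ satisfies it with constant $\lambda>0$ if $\lambda^2\,\mathbb{W}_p^2(\mu,\gamma)\le\mathcal{I}(\mu\|\gamma)$ for all $\mu\in\mathcal{P}(\mathcal{X})$ with $\mu\ll\gamma$. $\rho(\cdot)$ is the spectral radius; $\preceq$ and $\prec$ are entrywise inequalities ($\prec$ strict in every entry). When $\rho(R)<1$, a strictly positive vector $\delta$ with $R\delta\prec\delta$ exists. $W_{k,p}=(\mathbb{W}_p(\mu_k^1,\mu_\star^1),\dots,\mathbb{W}_p(\mu_k^M,\mu_\star^M))^\top$; the indices drawn at different iterations are independent. ''Converges exponentially fast in expected distance with rate $\rho(A)$'' means that $\mathbb{E}[W_{k+m,p}]\preceq A^mW_{k,p}$ for all $m\ge0$, so that $\limsup_{m\to\infty}\|\mathbb{E}[W_{k+m,p}]\|^{1/m}\le\rho(A)<1$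 (here $A=\frac1MR+\frac{M-1}MI_M$). *)

(* Defs.v *)
From HB Require Import structures.
From mathcomp Require Import all_boot all_order all_algebra.
From mathcomp Require Import all_classical all_reals all_analysis.
From mathcomp Require Import measurable_realfun complex.

Set Implicit Arguments.
Unset Strict Implicit.
Unset Printing Implicit Defensive.

Import Order.TTheory GRing.Theory Num.Theory.
Import numFieldNormedType.Exports.

Local Open Scope classical_set_scope.
Local Open Scope ring_scope.

#[short(type="completePMetricType")]
HB.structure Definition CompletePMetric (R : numDomainType) :=
  {T of Metric R T & Uniform_isComplete T & isPointed T}.

Notation borel T := (g_sigma_algebraType (@open T)).

(* The outer measure generated by measurable rectangles.  For sigma-finite
   factors its restriction to the product sigma-algebra is the product measure;
   it is only ever integrated against functions on that sigma-algebra.  Covers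
   are indexed by a subset of nat because rectangles over an empty index type
   are never empty. *)
Definition product_measure (R : realType) (I : finType)
    (d : I -> measure_display) (T : forall i, measurableType (d i))
    (m : forall i, set (T i) -> \bar R) (A : set (forall i, T i)) : \bar R :=
  ereal_inf
    [set s | exists (D : pred nat) (B : nat -> forall i, set (T i)),
      [/\ forall k i, measurable (B k i),
          A `<=` \bigcup_(k in [set k | D k]) [set y | forall i, B k i (y i)] &
          s = (\sum_(0 <= k <oo | D k) \prod_i m i (B k i))%E]].

Definition lebesgue_rV (R : realType) (n : nat)
    (A : set (borel 'rV[R]_n)) : \bar R :=
  @product_measure R 'I_n _ (fun=> measurableTypeR R)
    (fun=> (@lebesgue_measure R : set (measurableTypeR R) -> \bar R))
    [set y | A (\row_i y i)].

Section EuclideanCalculus.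
Context {R : realType} {n : nat}.
Implicit Types (U : set 'rV[R]_n) (f u w psi : 'rV[R]_n -> R).

Definition partial (i : 'I_n) f (v : 'rV[R]_n) : R :=
  'D_(delta_mx 0 i) f v.

Definition partials (s : seq 'I_n) f : 'rV[R]_n -> R := foldr partial f s.

Definition smooth_on U f : Prop :=
  forall (s : seq 'I_n) v, U v ->
    {for v, continuous (partials s f)} /\
    (forall i, derivable (partials s f) v (delta_mx 0 i)).

Definition test_function U psi : Prop :=
  smooth_on setT psi /\
  exists K : set 'rV[R]_n,
    [/\ compact K, K `<=` U & forall v, ~ K v -> psi v = 0].

Definition locally_integrable_on U w : Prop :=
  measurable_fun (U : set (borel 'rV[R]_n)) (w : borel 'rV[R]_n -> R) /\
  forall K : set 'rV[R]_n, compact K -> K `<=` U ->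
    (\int[@lebesgue_rV R n]_(v in K) (`|w v|%:E) < +oo)%E.

Definition weak_partial U (i : 'I_n) u w : Prop :=
  [/\ locally_integrable_on U u, locally_integrable_on U w &
      forall psi, test_function U psi ->
        (\int[@lebesgue_rV R n]_(v in U) (u v * partial i psi v)%:E =
         - \int[@lebesgue_rV R n]_(v in U) (w v * psi v)%:E)%E].

End EuclideanCalculus.

Section RiemannianManifold.
Context {R : realType} (X : completePMetricType R).

(* The atlas is indexed by the points of X: [cmap x] is a chart around x,
   defined on [cdom x], with inverse [cinv x].  The tangent space at z is
   identified with row vectors through the chart [cmap z], so [metric z] is the
   Gram matrix at z in that chart. *)
Record atlas_metric := AtlasMetric {
  rdim : nat;
  cdom : X -> set X;
  cmap : X -> X -> 'rV[R]_rdim;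
  cinv : X -> 'rV[R]_rdim -> X;
  metric : X -> 'M[R]_rdim }.

Arguments cdom : clear implicits.
Arguments cmap : clear implicits.
Arguments cinv : clear implicits.
Arguments metric : clear implicits.

Variable g : atlas_metric.

Definition chart_image (x : X) : set 'rV[R]_(rdim g) := cmap g x @` cdom g x.

(* Differential at v of the transition from the chart at x to the chart at the
   point z = cinv x v; with row tangent vectors it acts by w |-> w *m J. *)
Definition chart_jacobian (x : X) (v : 'rV[R]_(rdim g)) : 'M[R]_(rdim g) :=
  \matrix_(i, j) partial i (fun w => cmap g (cinv g x v) (cinv g x w) 0 j) v.

Definition metric_in_chart (x : X) (v : 'rV[R]_(rdim g)) : 'M[R]_(rdim g) :=
  chart_jacobian x v *m metric g (cinv g x v) *m (chart_jacobian x v)^T.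

Definition is_smooth_atlas : Prop :=
  [/\ forall x, [/\ cdom g x x, open (cdom g x) & open (chart_image x)],
      forall x y, cdom g x y -> cinv g x (cmap g x y) = y,
      forall x y, cdom g x y -> {for y, continuous (cmap g x)},
      forall x v, chart_image x v -> {for v, continuous (cinv g x)} &
      forall x y (j : 'I_(rdim g)),
        smooth_on (cmap g x @` (cdom g x `&` cdom g y))
          (fun v => cmap g y (cinv g x v) 0 j)].

Definition is_smooth_metric : Prop :=
  [/\ forall z, (metric g z)^T = metric g z,
      forall z (w : 'rV[R]_(rdim g)), w != 0 ->
        0 < (w *m metric g z *m w^T) 0 0 &
      forall x (i j : 'I_(rdim g)),
        smooth_on (chart_image x) (fun v => metric_in_chart x v i j)].

(* Parametrised over the whole line; a C^1 curve on [0, 1] can be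
   reparametrised, with the same length, so as to extend to the line by
   constants. *)
Definition C1_curve (c : R -> X) : Prop :=
  continuous c /\
  forall x t, cdom g x (c t) ->
    derivable (cmap g x \o c) t 1 /\
    {for t, continuous (derive1 (cmap g x \o c))}.

Definition speed (c : R -> X) (t : R) : R :=
  let w := derive1 (cmap g (c t) \o c) t in
  Num.sqrt ((w *m metric g (c t) *m w^T) 0 0).

Definition curve_length (c : R -> X) : \bar R :=
  (\int[@lebesgue_measure R]_(t in `[0%R, 1%R]) (speed c t)%:E)%E.

(* Values are finite because [mdist] is, so X is connected. *)
Definition is_geodesic_distance : Prop :=
  forall x y : X, (mdist x y)%:E =
    ereal_inf [set curve_length c | c in
      [set c | [/\ C1_curve c, c 0 = x & c 1 = y]]].

Definition is_volume (vol : set (borel X) -> \bar R) : Prop :=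
  forall x (A : set (borel X)), measurable A -> A `<=` cdom g x ->
    (vol A = \int[@lebesgue_rV R (rdim g)]_(v in cmap g x @` A)
               (Num.sqrt (\det (metric_in_chart x v)))%:E)%E.

(* [G z] is a covector (column) in the chart at z. *)
Definition covector_in_chart (G : X -> 'cV[R]_(rdim g)) (x : X)
    (v : 'rV[R]_(rdim g)) : 'cV[R]_(rdim g) :=
  chart_jacobian x v *m G (cinv g x v).

Definition weak_gradient (u : X -> R) (G : X -> 'cV[R]_(rdim g)) : Prop :=
  forall x (i : 'I_(rdim g)),
    weak_partial (chart_image x) i (u \o cinv g x)
      (fun v => covector_in_chart G x v i 0).

Definition covector_sqnorm (G : X -> 'cV[R]_(rdim g)) (z : X) : R :=
  ((G z)^T *m invmx (metric g z) *m G z) 0 0.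

End RiemannianManifold.

Arguments cdom {R X}.
Arguments cmap {R X}.
Arguments cinv {R X}.
Arguments metric {R X}.

(* A smooth complete connected Riemannian manifold, presented with its geodesic
   distance as the metric of the carrier, which is complete.  [volume] is
   determined by [is_volume] because X is second countable. *)
Record riemannian (R : realType) (X : completePMetricType R) := Riemannian {
  ratlas :> atlas_metric X;
  volume : {measure set (borel X) -> \bar R};
  riemannian_second_countable : @second_countable X;
  riemannian_smooth_atlas : is_smooth_atlas ratlas;
  riemannian_smooth_metric : is_smooth_metric ratlas;
  riemannian_geodesic_distance : is_geodesic_distance ratlas;
  riemannian_volume : is_volume ratlas volume }.

Section Measures.
Context {R : realType} (X : completePMetricType R) (g : riemannian X) (p : R).
Implicit Types mu nu rho gam : probability (borel X) R.

(* Absolutely continuous with finite p-th moment. *)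
Definition Pp mu : Prop :=
  mu `<< volume g /\
  exists x0 : X, (\int[mu]_x ((mdist x0 x `^ p)%:E) < +oo)%E.

Definition coupling mu nu
    (gam : probability (borel X * borel X)%type R) : Prop :=
  forall A : set (borel X), measurable A ->
    gam (A `*` setT) = mu A /\ gam (setT `*` A) = nu A.

Definition Wp mu nu : \bar R :=
  ereal_inf
    [set poweR (\int[gam]_z ((mdist (z.1 : X) (z.2 : X) `^ p)%:E))%E p^-1 |
      gam in coupling mu nu].

Definition Wball (eps : \bar R) rho : set (probability (borel X) R) :=
  [set mu | Pp mu /\ (Wp mu rho < eps)%E].

Definition truncated_log (k : nat) (r : R) : R :=
  fine (maxe (- k%:R%:E) (mine (k%:R%:E) (lne r%:E)))%E.

(* [G] is the gradient of log (d mu / d nu).  The density may vanish, so log is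
   differentiated weakly through its truncations at height k, whose gradient is
   [G] where |log| < k and 0 elsewhere; here [lne 0 = -oo]. *)
Definition is_log_gradient mu nu (G : X -> 'cV[R]_(rdim g)) : Prop :=
  exists h : borel X -> R,
    [/\ measurable_fun setT h, forall x, 0 <= h x,
        forall A : set (borel X), measurable A ->
          (mu A = \int[nu]_(x in A) (h x)%:E)%E &
        forall k : nat,
          weak_gradient (fun x => truncated_log k (h x))
            (fun x => if (`|lne (h x)%:E| < k%:R%:E)%E then G x else 0)].

(* For nu << vol all log-gradients coincide mu-a.e., so the infimum selects the
   common value, or +oo when log (d mu / d nu) has no weak gradient. *)
Definition fisher mu nu : \bar R :=
  if `[< mu `<< nu >] then
    ereal_inf [set (\int[mu]_x (covector_sqnorm G x)%:E)%E |
                 G in is_log_gradient mu nu]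
  else +oo%E.

Definition transportation_information (lam : R) nu : Prop :=
  forall mu, mu `<< nu ->
    ((lam ^+ 2)%:E * (Wp mu nu) ^+ 2 <= fisher mu nu)%E.

End Measures.

Definition cylinders (R : realType) (I : Type)
    (X : I -> completePMetricType R) : set (set (forall i, X i)) :=
  [set C | exists i (B : set (borel (X i))),
     measurable B /\ C = [set y | B (y i)]].

Arguments cylinders {R I} X _.

Notation prod_space X := (g_sigma_algebraType (cylinders X)).

Section MeanField.
Context {R : realType} {M : nat} (X : 'I_M -> completePMetricType R).
Context (g : forall i, riemannian (X i)).

Definition profile : Type := forall i, probability (borel (X i)) R.

Definition volume_product : set (prod_space X) -> \bar R :=
  @product_measure R 'I_M _ (fun i => borel (X i))
    (fun i => volume (g i) : set (borel (X i)) -> \bar R).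

(* Geodesic distance of the product Riemannian metric. *)
Definition prod_dist (x y : prod_space X) : R :=
  Num.sqrt (\sum_i mdist (x i : X i) (y i) ^+ 2).

(* pi is the probability measure with density e^{-f} and it lies in P_p. *)
Definition is_gibbs_Pp (p : R) (f : prod_space X -> \bar R)
    (pi : probability (prod_space X) R) : Prop :=
  [/\ measurable_fun setT f, forall x, f x != -oo%E,
      forall A : set (prod_space X), measurable A ->
        (pi A = \int[volume_product]_(x in A) expeR (- f x))%E &
      exists x0, (\int[pi]_x ((prod_dist x0 x `^ p)%:E) < +oo)%E].

Definition others (i : 'I_M) := {j : 'I_M | j != i}.

Definition fill (i : 'I_M) (x : X i)
    (y : forall k : others i, X (val k)) : prod_space X :=
  fun j => match @eqP _ j i with
           | ReflectT e => ecast k (X k) (esym e) x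
           | ReflectF ne => y (exist _ j (introN eqP ne))
           end.

Definition others_measure (i : 'I_M) (mu : profile) :
    set (prod_space (fun k : others i => X (val k))) -> \bar R :=
  @product_measure R (others i) _ (fun k => borel (X (val k)))
    (fun k => mu (val k) : set (borel (X (val k))) -> \bar R).

Variable f : prod_space X -> \bar R.

Definition cond_energy (i : 'I_M) (mu : profile) (x : X i) : \bar R :=
  (\int[others_measure (i := i) mu]_y f (fill x y))%E.

Definition normaliser (i : 'I_M) (mu : profile) : \bar R :=
  (\int[volume (g i)]_x expeR (- cond_energy mu x))%E.

(* nu is the probability measure with density proportional to
   exp (- cond_energy); the first clause says that the expectation of f is not
   of the form oo - oo, to which the library integral gives a value. *)
Definition is_optimality (i : 'I_M) (mu : profile)
    (nu : probability (borel (X i)) R) : Prop :=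
  [/\ {ae volume (g i), forall x,
        ((\int[others_measure (i := i) mu]_y (fun z => f (fill x z))^\+ y
            < +oo) \/
         (\int[others_measure (i := i) mu]_y (fun z => f (fill x z))^\- y
            < +oo))%E},
      (0 < normaliser i mu < +oo)%E &
      forall A : set (borel (X i)), measurable A ->
        (nu A = ((fine (normaliser i mu))^-1)%:E *
                \int[volume (g i)]_(x in A) expeR (- cond_energy mu x))%E].

Definition optimality_well_defined (i : 'I_M) (mu : profile) : Prop :=
  exists nu, is_optimality (i := i) mu nu.

(* Only the components mu j with j != i matter; where the map is not well
   defined it returns the arbitrary value [mu i]. *)
Definition optimality_map (i : 'I_M) (mu : profile) :
    probability (borel (X i)) R :=
  xget (mu i) [set nu | is_optimality (i := i) mu nu].

Definition fisher_smooth (p : R) (mustar : profile) (eps : 'I_M -> \bar R)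
    (i : 'I_M) (L : 'I_M -> R) : Prop :=
  forall mu : profile,
    (forall j, j != i -> Wball (g j) p (eps j) (mustar j) (mu j)) ->
    (fisher (g i) (optimality_map i mu) (optimality_map i mustar) <=
      (\sum_(j < M | j != i) (L j)%:E * Wp p (mu j) (mustar j)) ^+ 2)%E.

Definition cavi_step (i : 'I_M) (mu : profile) : profile :=
  fun j => if j == i then optimality_map j mu else mu j.

Fixpoint cavi (draws : nat -> 'I_M) (mu : profile) (m : nat) : profile :=
  if m is m'.+1 then cavi_step (draws m') (cavi draws mu m') else mu.

End MeanField.

(* Independent draws, each uniform on the M indices. *)
Definition iid_uniform (R : realType) (M : nat) (d : measure_display)
    (Omega : measurableType d) (P : probability Omega R)
    (I : nat -> Omega -> 'I_M) : Prop :=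
  [/\ forall k i, measurable (I k @^-1` [set i]),
      forall k i, P (I k @^-1` [set i]) = (M%:R^-1)%:E &
      forall (ks : seq nat) (s : nat -> 'I_M), uniq ks ->
        P (\bigcap_(k in [set` ks]) (I k @^-1` [set s k])) =
          (\prod_(k <- ks) P (I k @^-1` [set s k]))%E].

Definition spectral_radius (R : realType) (n : nat) (A : 'M[R]_n) : R :=
  sup [set Normc.normc z | z in
        [set z : R[i] | eigenvalue (map_mx (real_complex R) A) z]].

(* Main.v *)
(** The transportation-information inequality bounds [W_p(mu_i, mustar_i)] after an
    update of block [i] by the root of a relative Fisher information, which
    Fisher-smoothness bounds by [sum_j L_ij W_j]; dividing by [lam_i], the updated
    distance is at most [(R W)_i].  Since [R delta < delta], the balls of radii
    [c delta_i] are stable, so this bound applies along every trajectory, and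
    averaging over an independent uniform index gives [E W_(m+1) <= A E W_m], hence
    [E W_m <= A^m W_0].

    For the rate, let [theta] exceed the spectral radius of [A].  By Cayley-Hamilton,
    [A^m v] is killed by a product of shift operators [S - z], with [z] running over
    the eigenvalues of [A]; removing one factor at a time shows that [A^m v] is
    [O(theta^m)].  Pairing an eigenvector with [delta], as in the bounds of Collatz
    and Wielandt, shows that the spectral radius of [A] is less than 1. *)

Require Import Defs.
From HB Require Import structures.
From mathcomp Require Import all_boot all_order all_algebra.
From mathcomp Require Import all_classical all_reals all_analysis.
From mathcomp Require Import measurable_realfun complex.
From mathcomp Require Import ring lra.
Set Implicit Arguments.
Unset Strict Implicit.
Unset Printing Implicit Defensive.
Import Order.TTheory GRing.Theory Num.Theory.
Import numFieldNormedType.Exports.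
Local Open Scope classical_set_scope.
Local Open Scope ring_scope.

(** * Powers and spectral radius of nonnegative matrices *)

Lemma geometric_recursion_bound (F : numFieldType) (a : nat -> F)
    (z theta K : F) :
  `|z| < theta ->
  (forall m, `|a m.+1 - z * a m| <= K * theta ^+ m) ->
  exists K', forall m, `|a m| <= K' * theta ^+ m.
Proof.
move=> zt aK.
have t0 : 0 < theta by exact: le_lt_trans zt.
have zt0 : 0 < theta - `|z| by rewrite subr_gt0.
have K0 : 0 <= K by have := aK 0%N; rewrite expr0 mulr1; exact: le_trans.
(* The summand [B = K / (theta - |z|)] solves [K + |z| * B = theta * B], which closes the induction
   step; the other summand covers [m = 0]. *)
exists (`|a 0%N| + K / (theta - `|z|)); elim=> [|m IH].
  by rewrite expr0 mulr1 lerDl divr_ge0// ltW.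
rewrite -[a m.+1](subrK (z * a m)) (le_trans (ler_normD _ _))//.
rewrite normrM (le_trans (lerD (aK m) (ler_wpM2l (normr_ge0 z) IH)))//.
rewrite exprS !mulrA -mulrDl ler_pM2r ?exprn_gt0//.
rewrite -subr_ge0.
have -> : (`|a 0%N| + K / (theta - `|z|)) * theta -
    (K + `|z| * (`|a 0%N| + K / (theta - `|z|))) = `|a 0%N| * (theta - `|z|).
  by field; rewrite gt_eqF.
by rewrite mulr_ge0// ltW.
Qed.

(** The vector [(A - z) v] is killed by the product without the factor of [z], so induction bounds
    its orbit. That orbit is the defect [a (m+1) - z * a m] of the orbit of [v]. *)
Lemma annihilated_orbit_bound (F : numFieldType) n (A : 'M[F]_n.+1)
    (theta : F) (zs : seq F) (v : 'cV[F]_n.+1) :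
  {in zs, forall z, `|z| < theta} ->
  horner_mx A (\prod_(z <- zs) ('X - z%:P)) *m v = 0 ->
  forall i, exists K, forall m, `|(A ^+ m *m v) i 0| <= K * theta ^+ m.
Proof.
elim: zs v => [|z zs IH] v zt.
  rewrite big_nil rmorph1 mul1mx => -> i.
  by exists 0 => m; rewrite mulmx0 mxE normr0 mul0r.
rewrite big_cons mulrC rmorphM/= -mulmxE -mulmxA => /IH IHv i.
have [|K KP] := IHv _ i.
  by move=> y yzs; apply: zt; rewrite inE yzs orbT.
apply: (@geometric_recursion_bound _ _ z theta K).
  by apply: zt; rewrite inE eqxx.
move=> m; apply: le_trans (KP m); rewrite le_eqVlt; apply/orP; left; apply/eqP.
congr (`| _ |).
rewrite rmorphB/= horner_mx_X horner_mx_C mulmxBl mulmxBr mulmxA.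
by rewrite mul_scalar_mx -scalemxAr mulmxE -exprSr !mxE.
Qed.

Lemma orbit_bound (C : numClosedFieldType) n (A : 'M[C]_n) (theta : C)
    (v : 'cV[C]_n) :
  (forall z, eigenvalue A z -> `|z| < theta) ->
  forall i, exists K, forall m, `|(A ^+ m *m v) i 0| <= K * theta ^+ m.
Proof.
case: n A v => [|n] A v zt; first by case.
have [zs zsE] := closed_field_poly_normal (char_poly A).
rewrite (monicP (char_poly_monic A)) scale1r in zsE.
apply: (@annihilated_orbit_bound _ _ _ _ zs).
  move=> z zzs; apply: zt; rewrite eigenvalue_root_char zsE.
  by rewrite root_prod_XsubC.
by rewrite -zsE Cayley_Hamilton mul0mx.
Qed.

Lemma normc_norm (R : rcfType) (z : R[i]) :
  real_complex R (Normc.normc z) = `|z|.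
Proof. by case: z. Qed.

Lemma normc_ge0 (R : rcfType) (z : R[i]) : 0 <= Normc.normc z.
Proof. by case: z => a b; exact: sqrtr_ge0. Qed.

(** A left eigenvector [v] satisfies |z| |v| <= |v| A entrywise. Pairing with [delta] gives |z| S <=
    |v| A delta <= theta S, where S = |v| delta is positive. *)
Lemma nonneg_eigenvalue_le (R : realType) n (A : 'M[R]_n) (delta : 'cV[R]_n)
    (theta : R) (z : R[i]) :
  (forall i j, 0 <= A i j) -> (forall i, 0 < delta i 0) ->
  (forall i, (A *m delta) i 0 <= theta * delta i 0) ->
  eigenvalue (map_mx (real_complex R) A) z -> Normc.normc z <= theta.
Proof.
move=> A0 d0 Ad /eigenvalueP[v vz v0].
pose S := \sum_i Normc.normc (v 0 i) * delta i 0.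
have S0 : 0 < S.
  have [i vi] : exists i, v 0 i != 0.
    apply/existsP; apply: contraNT v0 => /existsPn vi.
    by apply/eqP/rowP => i; rewrite mxE; apply/eqP/negPn/vi.
  rewrite /S (bigD1 i)//= ltr_wpDr//.
    by apply: sumr_ge0 => j _; rewrite mulr_ge0 ?normc_ge0// ltW.
  rewrite mulr_gt0// lt_neqAle normc_ge0 andbT eq_sym.
  by apply: contra vi => /eqP/Normc.eq0_normc ->.
rewrite -(ler_pM2r S0).
apply: (@le_trans _ _ (\sum_i Normc.normc (v 0 i) * (A *m delta) i 0)).
  have vzj j : Normc.normc z * Normc.normc (v 0 j) <=
      \sum_i Normc.normc (v 0 i) * A i j.
    rewrite -Normc.normcM.
    have -> : z * v 0 j = \sum_i v 0 i * real_complex R (A i j).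
      have /rowP/(_ j) := vz; rewrite !mxE => <-.
      by apply: eq_bigr => i _; rewrite !mxE.
    rewrite -lecR normc_norm (le_trans (ler_norm_sum _ _ _))//.
    rewrite rmorph_sum ler_sum// => i _.
    rewrite rmorphM/= normc_norm normrM ler_wpM2l//.
    by rewrite ger0_norm// lecR.
  rewrite /S mulr_sumr.
  apply: (@le_trans _ _ (\sum_j (\sum_i Normc.normc (v 0 i) * A i j) * delta j 0)).
    by apply: ler_sum => j _; rewrite mulrA ler_wpM2r// ltW.
  under eq_bigr do rewrite mulr_suml.
  rewrite exchange_big/=; apply: ler_sum => i _.
  rewrite !mxE mulr_sumr; apply: ler_sum => j _.
  by rewrite mulrA.
rewrite /S mulr_sumr ler_sum// => i _.
by rewrite mulrCA ler_wpM2l ?normc_ge0.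
Qed.

Lemma nonneg_eigenvalue_le_spectral_radius (R : realType) n (A : 'M[R]_n)
    (z : R[i]) :
  (forall i j, 0 <= A i j) ->
  eigenvalue (map_mx (real_complex R) A) z ->
  Normc.normc z <= spectral_radius A.
Proof.
move=> A0 zA; apply: ub_le_sup; last by exists z.
(* [sup] is an upper bound only of a set bounded above. Here the all-ones vector serves as [delta],
   each row sum being at most the sum of all entries. *)
exists (\sum_i \sum_j A i j) => _ [y yA <-].
apply: (@nonneg_eigenvalue_le _ _ _ (const_mx 1) _ _ A0) yA.
  by move=> i; rewrite mxE.
move=> i; rewrite !mxE mulr1; under eq_bigr do rewrite mxE mulr1.
rewrite [leRHS](bigD1 i)//= lerDl; apply: sumr_ge0 => k _.
exact: sumr_ge0.
Qed.

Lemma nonneg_spectral_radius_lt1 (R : realType) n (A : 'M[R]_n)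
    (delta : 'cV[R]_n) :
  (forall i j, 0 <= A i j) -> (forall i, 0 < delta i 0) ->
  (forall i, (A *m delta) i 0 < delta i 0) -> spectral_radius A < 1.
Proof.
move=> A0 d0 Ad.
(* The largest Collatz-Wielandt quotient. The base value 0 also covers an empty set of eigenvalues,
   whose [sup] is 0. *)
pose theta := \big[Num.max/0]_i ((A *m delta) i 0 / delta i 0).
have theta1 : theta < 1.
  by apply/bigmax_ltP; split => // i _; rewrite ltr_pdivrMr ?mul1r.
apply: le_lt_trans theta1; rewrite /spectral_radius.
set E := [set _ | _ in _].
have [->|E0] := eqVneq E set0.
  by rewrite sup0; apply: bigmax_ge_id.
apply: ge_sup; first exact/set0P.
move=> _ [z zA <-]; apply: (nonneg_eigenvalue_le A0 d0 _ zA) => i.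
rewrite -ler_pdivrMr//.
exact: (le_bigmax _ (fun i => (A *m delta) i 0 / delta i 0)).
Qed.

Lemma spectral_radius_ge0 (R : realType) n (A : 'M[R]_n) :
  0 <= spectral_radius A.
Proof.
rewrite /spectral_radius; set E := [set _ | _ in _].
have [[[_ [z zA _]] hub]|/sup_out->//] := pselect (has_sup E).
apply: (@le_trans _ _ (Normc.normc z)); first exact: normc_ge0.
by apply: (ub_le_sup hub); exists z.
Qed.

Lemma nonneg_orbit_bound (R : realType) n (A : 'M[R]_n) (v : 'cV[R]_n)
    (theta : R) :
  (forall i j, 0 <= A i j) -> spectral_radius A < theta ->
  exists K, forall m i, (A ^+ m *m v) i 0 <= K * theta ^+ m.
Proof.
move=> A0 At.
have bnd : forall i, exists K, forall m, (A ^+ m *m v) i 0 <= K * theta ^+ m.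
  move=> i.
  have [|K KP] := @orbit_bound _ _ (map_mx (real_complex R) A)
      (real_complex R theta) (map_mx (real_complex R) v) _ i.
    move=> z zA; rewrite -normc_norm ltcR.
    exact: le_lt_trans (nonneg_eigenvalue_le_spectral_radius A0 zA) At.
  (* The constant from [orbit_bound] is complex; an inequality in [R[i]] implies the one between
     real parts. *)
  exists (complex.Re K) => m; have := KP m.
  rewrite -rmorphXn -map_mxM mxE => /(le_trans (real_ler_norm _)).
  have -> : K * real_complex R theta ^+ m = K * real_complex R (theta ^+ m).
    by rewrite rmorphXn.
  case: K {KP} => a b /=.
  rewrite lecE/= => /(_ _)/andP[|_]; first by apply/complex_realP; eexists.
  by rewrite mulr0 subr0.
have [K KP] := choice bnd.
have theta0 := ltW (le_lt_trans (spectral_radius_ge0 A) At).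
exists (\sum_i `|K i|) => m i; apply: le_trans (KP i m) _.
rewrite ler_wpM2r ?exprn_ge0// (le_trans (ler_norm _))//.
by rewrite (bigD1 i)//= lerDl; apply: sumr_ge0.
Qed.

(** * Expectations along a random scan *)

Section RandomScan.
Context {R : realType} {M : nat} {S : Type} (step : 'I_M -> S -> S) (s0 : S).

Fixpoint scan (draws : nat -> 'I_M) (m : nat) : S :=
  if m is m'.+1 then step (draws m') (scan draws m') else s0.

(** The mean of [phi] after [m] uniform draws, conditioned on the last draw first. As a finite
    average it is linear and monotone without any measurability. *)
Fixpoint scan_mean (m : nat) (phi : S -> R) : R :=
  if m is m'.+1 then M%:R^-1 * \sum_i scan_mean m' (phi \o step i) else phi s0.

Lemma eq_scan_mean m phi psi : phi =1 psi -> scan_mean m phi = scan_mean m psi.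
Proof. by move=> /funext ->. Qed.

Lemma scan_mean_ge0 m (phi : S -> R) :
  (forall s, 0 <= phi s) -> 0 <= scan_mean m phi.
Proof.
elim: m phi => [|m IH] phi phi0 //=.
apply: mulr_ge0; first by rewrite invr_ge0 ler0n.
by apply: sumr_ge0 => i _; apply: IH => s; exact: phi0.
Qed.

Lemma scan_mean_sum m (J : finType) (phi : J -> S -> R) (a : J -> R) :
  scan_mean m (fun s => \sum_j a j * phi j s) =
  \sum_j a j * scan_mean m (phi j).
Proof.
elim: m phi => [|m IH] phi //=.
under eq_bigr do rewrite /comp IH.
rewrite exchange_big mulr_sumr; apply: eq_bigr => j _.
by rewrite -mulr_sumr mulrCA.
Qed.

(** The one-step contraction is available only inside the balls, so the comparison is confined to a
    set that the steps preserve. *)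
Lemma le_scan_mean (good : S -> Prop) m phi psi :
  good s0 -> (forall i s, good s -> good (step i s)) ->
  (forall s, good s -> phi s <= psi s) -> scan_mean m phi <= scan_mean m psi.
Proof.
move=> g0 gS; elim: m phi psi => [|m IH] phi psi le_phi /=; first exact: le_phi.
rewrite ler_wpM2l ?invr_ge0 ?ler0n// ler_sum// => i _; apply: IH => s gs.
exact/le_phi/gS.
Qed.

(** * Law of the scan under independent uniform draws *)

Context {d : measure_display} {Omega : measurableType d}.
Context (P : probability Omega R) (I : nat -> Omega -> 'I_M).
Hypothesis iidI : iid_uniform P I.

Let mI k i : measurable (I k @^-1` [set i]).
Proof. by case: iidI => + _ _; apply. Qed.

(** Only finitely many draw sequences occur up to time [m], so [S] needs no sigma-algebra and [phi]
    is arbitrary; the induction splits on the last draw. *)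
Lemma measurable_scan d' (T : measurableType d') (phi : S -> T) m :
  measurable_fun setT (fun w => phi (scan (I^~ w) m)).
Proof.
elim: m phi => [|m IH] phi; first by rewrite /=; exact: measurable_cst.
move=> _ B mB; rewrite setTI.
rewrite (_ : _ @^-1` B = \big[setU/set0]_i (I m @^-1` [set i] `&`
    (fun w => (phi \o step i) (scan (I^~ w) m)) @^-1` B)).
  apply: bigsetU_measurable => i _; apply: measurableI => //.
  by rewrite -[X in measurable X]setTI; exact: IH.
apply/seteqP; split=> w.
  by move=> Bw; rewrite -bigcup_seq; exists (I m w) => //=; rewrite mem_index_enum.
by rewrite -bigcup_seq => -[i _ [/= <-]].
Qed.

Let cylinder (ks : seq nat) (s : nat -> 'I_M) : set Omega :=
  \bigcap_(k in [set` ks]) (I k @^-1` [set s k]).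

(* The cylinders constrain draws not yet used by [scan _ m], so that the induction
   on [m] can condition on one more draw. *)
Lemma integral_scan_cylinder m (phi : S -> R) ks s : (forall s, 0 <= phi s) ->
  uniq ks -> all (leq m) ks ->
  (\int[P]_(w in cylinder ks s) (phi (scan (I^~ w) m))%:E =
   (M%:R^-1 ^+ size ks * scan_mean m phi)%:E)%E.
Proof.
have mcyl ks' s' : measurable (cylinder ks' s').
  by apply: bigcap_measurableType => k _; exact: mI.
elim: m phi ks s => [|m IH] phi ks s phi0 uks mks.
  transitivity ((phi s0)%:E * P (cylinder ks s))%E.
    exact: (integral_cst P (mcyl ks s) (phi s0)%:E).
  have [_ PI Pcap] := iidI; rewrite muleC /cylinder Pcap//.
  rewrite EFinM; congr (_ * _)%E.
  elim: ks {uks mks} => [|k ks IHk]; first by rewrite big_nil.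
  by rewrite big_cons IHk PI exprS EFinM.
(* Splitting the cylinder by the value [i] of draw [m] prescribes one more draw; this produces the
   extra factor [M^-1], and on each piece the last step is [step i]. *)
pose si i k := if k == m then i else s k.
have mNks : m \notin ks.
  by apply/negP => /(allP mks); rewrite ltnn.
have cylE : cylinder ks s = \big[setU/set0]_i cylinder (m :: ks) (si i).
  apply/seteqP; split=> w.
    move=> sw; rewrite -bigcup_seq; exists (I m w) => [|k] /=.
      by rewrite mem_index_enum.
    rewrite inE /si => /predU1P[->|kks]; first by rewrite eqxx.
    case: eqP => [->//|_]; exact: sw.
  rewrite -bigcup_seq => -[i _ sw] k /= kks.
  have := sw k; rewrite /= inE kks orbT => /(_ isT); rewrite /si.
  by case: eqP => [km|//]; rewrite -km kks in mNks.
rewrite cylE ge0_integral_bigsetU//; last 4 first.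
- exact: index_enum_uniq.
- move=> i j _ _ [w [iw jw]].
  have := iw m; have := jw m; rewrite /= inE eqxx /= /si eqxx.
  by move=> /(_ isT) <- /(_ isT) ->.
- apply: measurable_funTS.
  exact: (measurable_scan (fun s => (phi s)%:E)).
- by move=> w _; rewrite lee_fin.
transitivity (\sum_i (M%:R^-1 ^+ (size ks).+1 * scan_mean m (phi \o step i))%:E)%E.
  apply: eq_bigr => i _.
  rewrite -(IH _ (m :: ks) (si i))/=; last 3 first.
  - by move=> x; exact: phi0.
  - by rewrite mNks.
  - by rewrite leqnn; apply: sub_all mks => k /ltnW.
  apply: eq_integral => w; rewrite inE => /(_ m); rewrite /= inE eqxx /si eqxx.
  by move=> /(_ isT) <-.
by rewrite sumEFin -mulr_sumr exprSr mulrA.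
Qed.

Lemma integral_scan m (phi : S -> R) : (forall s, 0 <= phi s) ->
  (\int[P]_w (phi (scan (I^~ w) m))%:E = (scan_mean m phi)%:E)%E.
Proof.
(* The cylinder over no draws is the whole space, but naming it takes some index; the draws
   themselves rule out [M = 0]. *)
move=> phi0; have [M0|[i0]] : M = 0%N \/ inhabited 'I_M.
- by case: M => [|M']; [left|right; exact: inhabits ord0].
- by have := I 0%N point; rewrite M0 => -[].
have := @integral_scan_cylinder m phi [::] (fun=> i0) phi0 isT isT.
by rewrite /cylinder set_nil bigcap_set0 expr0 mul1r.
Qed.

End RandomScan.

(** * Wasserstein distance and Fisher information *)

Section MeasurableDistance.

Lemma countable_bigcup_measurable d (T : measurableType d) J (D : set J)
    (F : J -> set T) :
  countable D -> (forall j, D j -> measurable (F j)) ->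
  measurable (\bigcup_(j in D) F j).
Proof.
move=> /countable_injP[f finj] mF.
rewrite (_ : \bigcup_(j in D) F j =
  \bigcup_n \bigcup_(j in [set j | D j /\ f j = n]) F j); last first.
  apply/seteqP; split=> [x [j Dj Fjx]|x [n _ [j [Dj _] Fjx]]]; last by exists j.
  by exists (f j) => //; exists j.
apply: bigcup_measurable => n _.
have [[j [Dj fj]]|nD] := pselect (exists j, D j /\ f j = n).
  rewrite (_ : [set _ | _] = [set j]) ?bigcup_set1; first exact: mF.
  apply/seteqP; split=> [k [Dk fk]|k -> //].
  by apply: finj; rewrite ?inE// fk.
rewrite (_ : [set _ | _] = set0) ?bigcup_set0//.
by apply/seteqP; split=> // j jn; apply: nD; exists j.
Qed.

Context {R : realType} (X : completePMetricType R).

Lemma open_borel (U : set X) : open U -> measurable (U : set (borel X)).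
Proof. by move=> oU; apply: sub_gen_smallest. Qed.

Hypothesis X2 : @second_countable X.

(** Couplings live on the product of the Borel sigma-algebras. By second countability, the open set
    where the distance is below [r] is a countable union of rectangles of basic open sets. *)
Lemma measurable_mdist :
  measurable_fun setT
    (fun z : borel X * borel X => mdist (z.1 : X) (z.2 : X)).
Proof.
have [B cB [oB bB]] := X2.
apply: (measurability _ (RGenInftyO.measurableE R)).
move=> _ [_ [r ->] <-]; rewrite setTI.
set S := _ @^-1` _.
rewrite (_ : S = \bigcup_(U in B) \bigcup_(V in [set V | B V /\ U `*` V `<=` S])
    (U `*` V)); last first.
  apply/seteqP; split=> [[x y]|z [U BU [V [BV UVS] zUV]]]; last exact: UVS.
  rewrite /S /= in_itv/= => xyr.
  (* Each of the two points may move by half of the gap. *)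
  pose e := (r - mdist x y) / 2.
  have e0 : 0 < e by rewrite divr_gt0// subr_gt0.
  have near_basis (t : X) : exists2 U, B U /\ U t & U `<=` ball t e.
    by have [U BUt Ute] := bB t _ (nbhsx_ballx t e e0); exists U.
  have [U [BU Ux] Ue] := near_basis x; have [V [BV Vy] Ve] := near_basis y.
  exists U => //; exists V => //; split => //= -[u v] [/= /Ue + /Ve].
  rewrite !ballEmdist /= in_itv/= => xu yv.
  apply: (le_lt_trans (metric_triangle u x v)).
  apply: (le_lt_trans (lerD (lexx _) (metric_triangle x y v))).
  by rewrite (metric_sym u x); rewrite /e in xu yv; lra.
apply: countable_bigcup_measurable => // U BU.
apply: countable_bigcup_measurable => [|V [BV _]].
  by apply: sub_countable cB; apply: subset_card_le => V [].
by apply: measurableX; apply: open_borel; exact: oB.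
Qed.

Lemma measurable_mdist_powR (p : R) :
  measurable_fun setT
    (fun z : borel X * borel X => (mdist (z.1 : X) (z.2 : X) `^ p)%:E).
Proof.
apply/measurable_EFinP.
exact: (measurableT_comp (measurable_powR p) measurable_mdist).
Qed.

Lemma measurable_mdistl_powR (p : R) (x0 : X) :
  measurable_fun setT (fun x : borel X => (mdist x0 (x : X) `^ p)%:E).
Proof.
exact: (measurableT_comp (measurable_mdist_powR p)
  (pair1_measurable (x0 : borel X))).
Qed.

End MeasurableDistance.

(** * Moments, Wasserstein balls and the transportation-information bound *)

Section Wasserstein.
Context {R : realType} (X : completePMetricType R) (g : riemannian X) (p : R).
Implicit Types mu nu : probability (borel X) R.

(** The fixed-point equation for [mustar] is an equality on measurable sets only; this carries it
    over to the Fisher information. *)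
Lemma fisher_eq_measure mu nu1 nu2 :
  (forall A : set (borel X), measurable A -> nu1 A = nu2 A) ->
  fisher g mu nu1 = fisher g mu nu2.
Proof.
move=> nu12.
have domE : (mu `<< nu1) <-> (mu `<< nu2).
  by split=> dom A A0; apply: dom => B mB BA; [rewrite nu12|rewrite -nu12];
    rewrite ?A0.
have logE : is_log_gradient (g := g) mu nu1 = is_log_gradient (g := g) mu nu2.
  apply/funext => G; apply/propext; split=> -[h [mh h0 hE hG]];
    exists h; split => // A mA; rewrite hE//; apply: eq_measure_integral => B mB _.
  - by rewrite /= nu12.
  - by rewrite /= nu12.
by rewrite /fisher logE; congr (if _ then _ else _); exact: asbool_equiv_eq.
Qed.

Lemma fisher_lty_dominates mu nu :
  (fisher g mu nu < +oo)%E -> mu `<< nu.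
Proof. by rewrite /fisher; case: asboolP. Qed.

Lemma Wp_ge0 mu nu : (0 <= Wp p mu nu)%E.
Proof. by apply/ereal_infP => _ [gam _ <-]; exact: poweR_ge0. Qed.

Lemma Wball_fin_num (r : R) mu nu :
  Wball g p r%:E nu mu -> Wp p mu nu \is a fin_num.
Proof.
move=> [_ Wr]; rewrite ge0_fin_numE ?Wp_ge0//.
exact: lt_trans Wr (ltry _).
Qed.

Lemma WballS (r s : \bar R) mu nu :
  (r <= s)%E -> Wball g p r nu mu -> Wball g p s nu mu.
Proof. by move=> rs [? Wr]; split=> //; exact: lt_le_trans rs. Qed.

(** By the triangle inequality, [mdist x z] is at most twice the larger of the other two
    distances. *)
Lemma powR_triangle (x y z : X) : 0 <= p ->
  mdist x z `^ p <= 2 `^ p * (mdist x y `^ p + mdist y z `^ p).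
Proof.
move=> p0; have tri := metric_triangle x y z.
have d0 (u v : X) : 0 <= mdist u v by exact: mdist_ge0.
have step (a b : R) : 0 <= a -> 0 <= b -> a <= b -> mdist x z <= a + b ->
    mdist x z `^ p <= 2 `^ p * (a `^ p + b `^ p).
  move=> a0 b0 ab xz; apply: (@le_trans _ _ ((2 * b) `^ p)).
    by rewrite ge0_ler_powR ?nnegrE ?mulr_ge0//; lra.
  by rewrite powRM// ler_wpM2l ?powR_ge0// lerDr powR_ge0.
have [ab|/ltW ba] := leP (mdist x y) (mdist y z).
  exact: step.
by rewrite [X in _ * X]addrC; apply: step => //; rewrite addrC.
Qed.

(** A finite infimum provides a coupling of finite cost. Integrating [powR_triangle] against it
    bounds the moment of [mu] by that of [nu] and the cost. *)
Lemma moment_Wp_lty mu nu (x0 : X) : 0 < p ->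
  (Wp p mu nu < +oo)%E ->
  (\int[nu]_x ((mdist x0 x `^ p)%:E) < +oo)%E ->
  (\int[mu]_x ((mdist x0 x `^ p)%:E) < +oo)%E.
Proof.
move=> p0 /ereal_inf_lt[_ [gam gamC <-]] gamy nuy.
have {gamy} := lty_poweRy (invr_neq0 (lt0r_neq0 p0)) gamy.
set cost := (\int[gam]_z _)%E => costy.
have X2 := riemannian_second_countable g.
have m0 := measurable_mdistl_powR X2 p x0.
have pow0 (x y : X) : (0 <= (mdist x y `^ p)%:E)%E by rewrite lee_fin powR_ge0.
have muE : (\int[mu]_x ((mdist x0 x `^ p)%:E) =
            \int[gam]_z ((mdist x0 (z.1 : X) `^ p)%:E))%E.
  transitivity (\int[pushforward gam fst]_x ((mdist x0 (x : X) `^ p)%:E))%E.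
    apply: eq_measure_integral => A mA _; rewrite /pushforward.
    apply: (etrans (esym (gamC A mA).1)); congr (gam _).
    by apply/seteqP; split=> z; [case|].
  by rewrite ge0_integral_pushforward//; exact: measurable_fst.
have nuE : (\int[nu]_x ((mdist x0 x `^ p)%:E) =
            \int[gam]_z ((mdist x0 (z.2 : X) `^ p)%:E))%E.
  transitivity (\int[pushforward gam snd]_x ((mdist x0 (x : X) `^ p)%:E))%E.
    apply: eq_measure_integral => A mA _; rewrite /pushforward.
    apply: (etrans (esym (gamC A mA).2)); congr (gam _).
    by apply/seteqP; split=> z; [case|].
  by rewrite ge0_integral_pushforward//; exact: measurable_snd.
have m1 := measurableT_comp m0 (@measurable_fst _ _ (borel X) (borel X)).
have m2 := measurableT_comp m0 (@measurable_snd _ _ (borel X) (borel X)).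
have mc := measurable_mdist_powR X2 p.
rewrite muE; apply: (@le_lt_trans _ _ ((2 `^ p)%:E *
    \int[gam]_z ((mdist x0 (z.2 : X) `^ p)%:E +
                 (mdist (z.1 : X) (z.2 : X) `^ p)%:E))%E).
  rewrite -ge0_integralZl_EFin ?powR_ge0//; last 2 first.
  - by move=> z _; rewrite adde_ge0.
  - exact: emeasurable_funD.
  apply: ge0_le_integral => //.
  - by apply: emeasurable_funM => //; exact: emeasurable_funD.
  - move=> z _; rewrite -EFinD -EFinM lee_fin (metric_sym (z.1 : X)).
    exact/powR_triangle/ltW.
rewrite ge0_integralD// -nuE lte_mul_pinfty ?lee_fin ?powR_ge0//.
by rewrite lte_add_pinfty.
Qed.

Lemma Pp_Wp_lty mu nu : 0 < p ->
  mu `<< volume g -> Pp g p nu -> (Wp p mu nu < +oo)%E -> Pp g p mu.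
Proof.
move=> p0 muvol [_ [x0 nuy]] Wy; split=> //; exists x0.
exact: moment_Wp_lty Wy nuy.
Qed.

(* [h] need not be measurable, so the integral over a null set is compared with the
   integral against the zero measure. *)
Lemma density_dominates (m : {measure set (borel X) -> \bar R}) mu (a : \bar R)
    (h : X -> \bar R) :
  (forall A : set (borel X), measurable A ->
    mu A = (a * \int[m]_(x in A) h x)%E) -> mu `<< m.
Proof.
move=> muE; apply/null_content_dominatesP => A mA mA0.
rewrite muE// (eq_measure_integral mzero) ?integral_measure_zero ?mule0//.
move=> B mB BA; exact: ((measure0_null_setP m mA).2 mA0 B mB BA).
Qed.

Lemma transportation_Wp_le (lam s : R) mu nu :
  0 < lam -> 0 <= s -> transportation_information g p lam nu ->
  (fisher g mu nu <= s%:E ^+ 2)%E ->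
  (Wp p mu nu <= (s / lam)%:E)%E.
Proof.
move=> lam0 s0 TI Fs.
(* The transportation-information inequality presupposes absolute continuity, which finiteness of
   the Fisher information supplies. *)
have dom : mu `<< nu.
  by apply: fisher_lty_dominates; apply: le_lt_trans Fs _; rewrite expe2 ltry.
have := le_trans (TI _ dom) Fs.
have := Wp_ge0 mu nu; case: (Wp p mu nu) => [w|//|//].
- rewrite -!EFin_expe -EFinM !lee_fin => w0.
  rewrite -exprMn ler_pXn2r ?nnegrE ?mulr_ge0 ?(ltW lam0)//.
  by rewrite ler_pdivlMr// mulrC.
(* An infinite distance would make the left side infinite, against the finite bound. *)
- by rewrite expe2 mulyy gt0_muley ?lte_fin ?exprn_gt0// expe2.
Qed.

End Wasserstein.

(** * Convergence of random-scan CAVI *)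

Lemma limn_esup_root_le (R : realType) (u : nat -> R) (r : R) :
  0 <= r -> (forall m, 0 <= u m) ->
  (forall theta, r < theta -> exists K, forall m, u m <= K * theta ^+ m) ->
  (limn_esup (fun m => (u m `^ m%:R^-1)%:E) <= r%:E)%E.
Proof.
move=> r0 u0 uK; apply/lee_addgt0Pr => e e0.
(* The growth bound is taken at [r + e / 2], so that the ratio [q < 1] to [r + e] absorbs [K] for
   large [m]. *)
have [|K uKm] := uK (r + e / 2); first by rewrite ltrDl divr_gt0.
have re0 : 0 < r + e by rewrite ltr_wpDl.
pose q := (r + e / 2) / (r + e).
have q0 : 0 <= q by rewrite divr_ge0 ?(ltW re0)// addr_ge0// divr_ge0// ltW.
have q1 : `|q| < 1 by rewrite ger0_norm// ltr_pdivrMr// mul1r; lra.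
have Kq : (fun m => K * q ^+ m) @ \oo --> (0 : R).
  rewrite -[X in _ --> X](mulr0 K); apply: cvgMr; exact: cvg_expr.
have [N _ NP] := cvgr_lt _ Kq _ ltr01.
(* The strict [N < m] excludes [m = 0], where the exponent [m^-1] is 0 and the root bound has no
   meaning. *)
apply: ge_ereal_inf; exists (ereal_sup
    ((fun m => (u m `^ m%:R^-1)%:E) @` [set m | (N < m)%N])).
  by exists [set m | (N < m)%N] => //; exists N.+1.
apply/ereal_supP => _ [m /= Nm <-]; rewrite lee_fin.
have m0 : (m%:R : R) != 0 by rewrite pnatr_eq0 -lt0n (leq_ltn_trans _ Nm).
have um : u m <= (r + e) ^+ m.
  apply: le_trans (uKm m) _.
  have -> : r + e / 2 = q * (r + e) by rewrite divfK// gt_eqF.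
  rewrite exprMn mulrA -[leRHS]mul1r ler_wpM2r ?exprn_ge0 ?(ltW re0)//.
  exact/ltW/NP/ltnW.
apply: (@le_trans _ _ (((r + e) ^+ m) `^ m%:R^-1)).
  by rewrite ge0_ler_powR ?nnegrE ?exprn_ge0 ?(ltW re0)// invr_ge0.
by rewrite -powR_mulrn ?(ltW re0)// -powRrM mulfV// powRr1// ltW.
Qed.

Lemma col_norm_le (R : realType) n (v : 'cV[R]_n) (a : R) :
  0 <= a -> (forall i, `|v i 0| <= a) -> `|v| <= a.
Proof.
move=> a0 va; rewrite [leLHS]mx_normrE; apply: bigmax_le => // -[i j] _ /=.
by rewrite ord1.
Qed.

Section Cavi.
Context {R : realType} {M : nat} (X : 'I_M -> completePMetricType R).
Context (g : forall i, riemannian (X i)) (p : R) (f : prod_space X -> \bar R).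
Context (mustar : profile X).
Implicit Types mu : profile X.

Lemma cavi_scan draws mu m :
  cavi g f draws mu m = scan (cavi_step g f) mu draws m.
Proof. by elim: m => //= m ->. Qed.

Lemma optimality_map_Wp_le (eps : 'I_M -> \bar R) (L : 'I_M -> R) (lam : R)
    i mu :
  0 < p -> 0 < lam -> (forall j, j != i -> 0 <= L j) ->
  Pp (g i) p (mustar i) ->
  (forall B : set (borel (X i)), measurable B ->
     mustar i B = optimality_map g f i mustar B) ->
  fisher_smooth g f p mustar eps i L ->
  transportation_information (g i) p lam (mustar i) ->
  optimality_well_defined g f i mu ->
  (forall j, j != i -> Wball (g j) p (eps j) (mustar j) (mu j)) ->
  (forall j, j != i -> Wp p (mu j) (mustar j) \is a fin_num) ->
  Pp (g i) p (optimality_map g f i mu) /\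
  (Wp p (optimality_map g f i mu) (mustar i) <=
    (\sum_(j | j != i) L j / lam * fine (Wp p (mu j) (mustar j)))%:E)%E.
Proof.
move=> p0 lam0 L0 Pstar starE FS TI wd mu_ball mu_fin.
have W_le : (Wp p (optimality_map g f i mu) (mustar i) <=
    (\sum_(j | j != i) L j / lam * fine (Wp p (mu j) (mustar j)))%:E)%E.
  have -> : \sum_(j | j != i) L j / lam * fine (Wp p (mu j) (mustar j)) =
      (\sum_(j | j != i) L j * fine (Wp p (mu j) (mustar j))) / lam.
    by rewrite mulr_suml; apply: eq_bigr => j _; rewrite mulrAC.
  apply: (transportation_Wp_le lam0 _ TI).
    apply: sumr_ge0 => j ji; rewrite mulr_ge0 ?L0// fine_ge0//.
    exact: Wp_ge0.
  (* Fisher-smoothness compares two values of the optimality map, so [mustar i] is first replaced by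
     its own. *)
  rewrite (fisher_eq_measure _ _ starE).
  apply: le_trans (FS mu mu_ball) _; rewrite -sumEFin le_eqVlt.
  apply/orP; left; apply/eqP; congr (_ ^+ 2)%E.
  by apply: eq_bigr => j ji; rewrite EFinM fineK// mu_fin.
(* The finite moment comes from the finite distance to [mustar i], absolute continuity from the
   explicit density. *)
split=> //; apply: (Pp_Wp_lty p0 _ Pstar); last exact: le_lt_trans W_le (ltry _).
have := xgetPex (mu i) wd; rewrite -/(optimality_map g f i mu) => -[_ _ optE].
exact: density_dominates optE.
Qed.

End Cavi.

Theorem theorem4 (R : realType) (M : nat)
    (X : 'I_M -> completePMetricType R) (g : forall i, riemannian (X i))
    (p : R) (f : prod_space X -> \bar R) (pi : probability (prod_space X) R)
    (mustar : profile X) (eps : 'I_M -> \bar R)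
    (L : 'M[R]_M) (lam : 'I_M -> R) (delta : 'cV[R]_M) (c : R)
    (muk : profile X)
    (d : measure_display) (Omega : measurableType d) (P : probability Omega R)
    (I : nat -> Omega -> 'I_M) :
  let Rmx : 'M[R]_M :=
    \matrix_(i, j) (if i == j then 0 else L i j / lam i) in
  let A : 'M[R]_M := M%:R^-1 *: Rmx + ((M%:R - 1) / M%:R)%:M in
  let W (mu : profile X) (i : 'I_M) : \bar R := Wp p (mu i) (mustar i) in
  let iterate (m : nat) (w : Omega) : profile X :=
    cavi g f (fun k => I k w) muk m in
  let EW (m : nat) (i : 'I_M) : \bar R := (\int[P]_w W (iterate m w) i)%E in
  1 <= p ->
  is_gibbs_Pp g p f pi ->
  (forall i, (0 < eps i)%E) ->
  (forall i j, j != i -> 0 <= L i j) ->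
  (forall i, 0 < lam i) ->
  (* the optimality maps are well defined where they are applied *)
  (forall i (mu : profile X),
     (forall j, j != i -> Wball (g j) p (eps j) (mustar j) (mu j)) ->
     optimality_well_defined g f i mu) ->
  (forall i, Pp (g i) p (mustar i)) ->
  (forall i (B : set (borel (X i))), measurable B ->
     mustar i B = optimality_map g f i mustar B) ->
  (forall i, fisher_smooth g f p mustar eps i (L i)) ->
  (forall i, transportation_information (g i) p (lam i) (mustar i)) ->
  spectral_radius Rmx < 1 ->
  (forall i, 0 < delta i 0) ->
  (forall i, (Rmx *m delta) i 0 < delta i 0) ->
  0 < c ->
  (forall i, ((c * delta i 0)%:E <= eps i)%E) ->
  (forall i, Wball (g i) p (c * delta i 0)%:E (mustar i) (muk i)) ->
  iid_uniform P I ->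
  [/\ forall i, (EW 1%N i <= \sum_j (A i j)%:E * W muk j)%E,
      forall w i,
        Wball (g i) p (c * delta i 0)%:E (mustar i) (iterate 1%N w i),
      forall m i, (EW m i <= \sum_j ((A ^+ m) i j)%:E * W muk j)%E,
      (limn_esup (fun m : nat =>
         (`|\col_i fine (EW m i)| `^ m%:R^-1)%:E) <= (spectral_radius A)%:E)%E &
      spectral_radius A < 1].
Proof.
move=> Rmx A W iterate EW p1 _ _ L0 lam0 wd Pstar starE FS TI _ d0 Rd c0 ce muk_ball
  iidI.
have p0 : 0 < p by exact: lt_le_trans p1.
have M0 : (0 < M)%N by exact: leq_ltn_trans (ltn_ord (I 0%N point)).
have M0R : (0 : R) < M%:R by rewrite ltr0n.
have R0 i j : 0 <= Rmx i j.
  rewrite mxE; case: eqVneq => // ij.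
  by rewrite divr_ge0 ?(ltW (lam0 i))// L0// eq_sym.
have AE (v : 'cV[R]_M) i : (A *m v) i 0 =
    M%:R^-1 * ((Rmx *m v) i 0 + (M%:R - 1) * v i 0).
  rewrite mulmxDl -scalemxAl mul_scalar_mx !mxE.
  by rewrite mulrDr; congr (_ + _); rewrite mulrA [_ / _]mulrC.
have A0 i j : 0 <= A i j.
  rewrite !mxE addr_ge0//.
    by have := R0 i j; rewrite mxE => ?; rewrite mulr_ge0 ?invr_ge0.
  by rewrite mulrn_wge0// divr_ge0// subr_ge0 ler1n.
(* [A delta] averages one copy of [Rmx delta] and [M - 1] copies of [delta]. *)
have Ad i : (A *m delta) i 0 < delta i 0.
  rewrite AE mulrC ltr_pdivrMr//.
  have := Rd i; lra.
pose good (mu : profile X) :=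
  forall i, Wball (g i) p (c * delta i 0)%:E (mustar i) (mu i).
(* [fine] sends an infinite distance to 0; on [good] profiles all distances are finite and nothing
   is lost. *)
pose V (mu : profile X) i : R := fine (W mu i).
have V0 mu i : 0 <= V mu i by apply: fine_ge0; exact: Wp_ge0.
have WV mu i : good mu -> W mu i = (V mu i)%:E.
  by move=> gmu; rewrite /V fineK//; exact: (Wball_fin_num (gmu i)).
have opt_le i mu : good mu -> Pp (g i) p (optimality_map g f i mu) /\
    (Wp p (optimality_map g f i mu) (mustar i) <=
      (\sum_j Rmx i j * V mu j)%:E)%E.
  move=> gmu.
  have mu_ball j : j != i -> Wball (g j) p (eps j) (mustar j) (mu j).
    by move=> _; apply: WballS (ce j) (gmu j).
  have [|Popt Wopt] := optimality_map_Wp_le p0 (lam0 i) (L0 i) (Pstar i) (starE i)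
      (FS i) (TI i) (wd i mu mu_ball) mu_ball.
    by move=> j _; exact: (Wball_fin_num (gmu j)).
  split=> //; rewrite (bigD1 i)//= mxE eqxx mul0r add0r.
  apply: le_trans Wopt _; rewrite lee_fin le_eqVlt; apply/orP; left; apply/eqP.
  by apply: eq_bigr => j ji; rewrite mxE eq_sym (negbTE ji).
(* In the balls [V <= c delta], hence [Rmx V <= c Rmx delta < c delta]: the updated block stays in
   its ball. *)
have RV_lt i mu : good mu -> \sum_j Rmx i j * V mu j < c * delta i 0.
  move=> gmu; apply: (@le_lt_trans _ _ (c * (Rmx *m delta) i 0)).
    rewrite mxE mulr_sumr; apply: ler_sum => j _.
    rewrite mulrCA ler_wpM2l// -lee_fin -WV//.
    by have [_ /ltW] := gmu j.
  by rewrite ltr_pM2l.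
have good_step i mu : good mu -> good (cavi_step g f i mu).
  move=> gmu j; rewrite /cavi_step; case: eqVneq => [ji|_]; last exact: gmu.
  have [Popt Wopt] := opt_le j mu gmu.
  split=> //; apply: le_lt_trans Wopt _; rewrite lte_fin; exact: RV_lt.
have V_step i mu : good mu ->
    V (cavi_step g f i mu) i <= \sum_j Rmx i j * V mu j.
  move=> gmu; rewrite -lee_fin -WV; last exact: good_step.
  by rewrite /W /cavi_step eqxx; have [] := opt_le i mu gmu.
have V_stepN i l mu : i != l -> V (cavi_step g f l mu) i = V mu i.
  by move=> il; rewrite /V /W /cavi_step (negbTE il).
have good_iterate m w : good (iterate m w).
  by elim: m => [|m IH] //=; exact: good_step.
pose e m : 'cV[R]_M := \col_i scan_mean (cavi_step g f) muk m (V^~ i).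
have EWE m i : EW m i = (e m i 0)%:E.
  rewrite mxE -(integral_scan _ _ iidI) => [|mu]; last exact: V0.
  by apply: eq_integral => w _; rewrite WV// /iterate cavi_scan.
have e0E : e 0%N = \col_i V muk i by apply/colP => i; rewrite !mxE.
have e_step m i : e m.+1 i 0 <= (A *m e m) i 0.
  rewrite AE [leLHS]mxE /= ler_wpM2l ?invr_ge0 ?ler0n//.
  (* Drawing [i] contributes at most the mean of [Rmx V]; the other [M - 1] draws leave component
     [i] unchanged. *)
  rewrite (bigD1 i)//=; apply: lerD.
    apply: (@le_trans _ _ (scan_mean (cavi_step g f) muk m
        (fun mu => \sum_j Rmx i j * V mu j))).
      by apply: (le_scan_mean (good := good)) => // mu; exact: V_step.
    rewrite scan_mean_sum mxE le_eqVlt; apply/orP; left; apply/eqP.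
    by apply: eq_bigr => j _; rewrite [e m j 0]mxE.
  rewrite (eq_bigr (fun=> e m i 0)); last first.
    move=> l li; rewrite [RHS]mxE; apply: eq_scan_mean => mu /=.
    by apply: V_stepN; rewrite eq_sym.
  by rewrite sumr_const cardC1 card_ord -[leLHS]mulr_natl -subn1 natrB.
(* The one-step bound iterates because multiplication by the nonnegative [A] preserves entrywise
   order. *)
have e_le m i : e m i 0 <= (A ^+ m *m e 0%N) i 0.
  elim: m i => [|m IH] i; first by rewrite expr0 mul1mx.
  apply: le_trans (e_step m i) _; rewrite exprS -mulmxE -mulmxA.
  by rewrite [leLHS]mxE [leRHS]mxE ler_sum// => j _; rewrite ler_wpM2l.
have EW_le m i : (EW m i <= \sum_j ((A ^+ m) i j)%:E * W muk j)%E.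
  rewrite EWE; under eq_bigr do rewrite WV// -EFinM.
  rewrite sumEFin lee_fin; apply: le_trans (e_le m i) _.
  rewrite mxE le_eqVlt; apply/orP; left; apply/eqP.
  by apply: eq_bigr => j _; rewrite e0E mxE.
split=> [i|w||//|].
- by have := EW_le 1%N i; rewrite expr1.
- exact: good_iterate.
- exact: EW_le.
- apply: limn_esup_root_le => [|m|theta At].
  + exact: spectral_radius_ge0.
  + exact: normr_ge0.
  have [K KP] := nonneg_orbit_bound (e 0%N) A0 At.
  have e0 m i : 0 <= e m i 0 by rewrite mxE; apply: scan_mean_ge0 => mu.
  exists K => m; apply: col_norm_le.
    (* Nonnegativity of [K * theta ^+ m] is read off at one entry, which exists since [M > 0]. *)
    by apply: le_trans (KP m (Ordinal M0)); apply: le_trans (e_le _ _); exact: e0.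
  move=> i; rewrite mxE EWE/= ger0_norm//.
  exact: le_trans (e_le m i) (KP m i).
- exact: nonneg_spectral_radius_lt1 A0 d0 Ad.
Qed.
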